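(* Let $c, i, n$ be positive integers such that $i \mid (2^{2^{n-1}} - i \cdot c)^2 + 1$ (divisibility in $\mathbb{Z}$). Then $i \mid F_n$.
   Context: $F_n = 2^{2^n} + 1$ denotes the $n$-th Fermat number, for every $n \in \mathbb{N} = \{0,1,2,\dots\}$. *)

(* Defs.v *)
From mathcomp Require Import all_boot all_order all_algebra.
Set Implicit Arguments.
Unset Strict Implicit.
Unset Printing Implicit Defensive.

Definition fermat (n : nat) : nat := 2 ^ (2 ^ n) + 1.

(* Main.v *)
Require Import Defs.
From mathcomp Require Import all_boot all_order all_algebra.
From mathcomp Require Import ring.
Import GRing.Theory Num.Theory.
Local Open Scope ring_scope.

(** For [n] positive, the Fermat number is [a ^+ 2 + 1] with [a] equal to 2 to the power 2^(n-1)
    ([fermat_sqr]). Modulo [i], [a] is congruent to [a - i * c], so the hypothesis carries over to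
    [a ^+ 2 + 1]. *)

Lemma fermat_sqr (n : nat) :
  (0 < n)%N -> (fermat n)%:Z = (2%:Z ^+ (2 ^ (n - 1))%N) ^+ 2 + 1.
Proof.
by case: n => // n _; rewrite subn1 /= -exprM -expnSr /fermat PoszD -(natz (2 ^ _)) natrX natz.
Qed.

Theorem theorem2p21 (c i n : nat) (hc : (0 < c)%N) (hi : (0 < i)%N)
    (hn : (0 < n)%N)
    (hdvd : (i%:Z %| (2%:Z ^+ (2 ^ (n - 1))%N - i%:Z * c%:Z) ^+ 2 + 1)%Z) :
  (i %| fermat n)%N.
Proof.
(* Integer divisibility is divisibility of absolute values, so the two forms are convertible. *)
suff: (i%:Z %| (fermat n)%:Z)%Z by [].
rewrite fermat_sqr //; move: hdvd; set a := 2%:Z ^+ _.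
(* The last summand is the difference of squares of [a] and [a - i * c], a visible multiple of
   [i]. *)
have -> : a ^+ 2 + 1
    = (a - i%:Z * c%:Z) ^+ 2 + 1 + i%:Z * (c%:Z * (2 * a - i%:Z * c%:Z)).
  by ring.
by move=> hdvd'; rewrite rpredD // dvdz_mulr.
Qed.
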